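(* Let $N\in\mathbb N$ be odd and let $\mathbf u\in\mathbb R^3$ denote the mean velocity of the Maxwellian background $M$. The approximate collision operator $\mathcal C_N$ commutes with rotations relative to the moving background: for every orthogonal matrix $\mathbf O\in\mathbb R^{3\times3}$, $$\mathcal C_N\circ\mathsf T=\mathsf T\circ\mathcal C_N,\qquad \mathsf T=\tau_{-\mathbf u}\circ\mathsf T_{O}\circ\tau_{\mathbf u},$$ where $(\tau_{\mathbf u}f)(\mathbf v)=f(\mathbf v+\mathbf u)$ is the translation operator with shift $\mathbf u$ and $(\mathsf T_Of)(\mathbf v)=f(\mathbf O^\top\mathbf v)$ is the rotation operator.
   Context: Fixed Maxwellian: $M(\mathbf v)=\frac{\rho}{(2\pi\theta)^{3/2}}\exp\left(-\frac{|\mathbf v-\mathbf u|^2}{2\theta}\right)$ with $\rho>0$, $\mathbf u\in\mathbb R^3$, $\theta>0$. Collision kernel: $B(\mathbf v-\mathbf v_*,\boldsymbol\sigma)=|\mathbf v-\mathbf v_*|^{\gamma}\,b(\hat{\mathbf u}\cdot\boldsymbol\sigma)$, $\gamma\in(-3,1]$, with $b:[-1,1]\to\mathbb R$ integrable and $\hat{\mathbf u}=(\mathbf v-\mathbf v_* )/|\mathbf v-\mathbf v_*|$. Post-collisional velocities: $\acute{\mathbf v}=\frac12(\mathbf v+\mathbf v_* )+\frac12|\mathbf v-\mathbf v_*|\boldsymbol\sigma$, $\acute{\mathbf v}_*=\frac12(\mathbf v+\mathbf v_* )-\frac12|\mathbf v-\mathbf v_*|\boldsymbol\sigma$, $\boldsymbol\sigma\in\mathbb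 S^2$. Notation: $g=g(\mathbf v)$, $g_*=g(\mathbf v_* )$, $\acute g=g(\acute{\mathbf v})$, $\acute g_*=g(\acute{\mathbf v}_* )$. Boltzmann operator: $\mathcal C(f)(\mathbf v)=\int_{\mathbb R^3}\int_{\mathbb S^2}B\,(\acute f\acute f_*-ff_* )\,d\boldsymbol\sigma\,d\mathbf v_*$, with domain $\mathscr D(\mathcal C)=\{f\in L^1_2(\mathbb R^3):\mathcal C(f)\in L^1_k(\mathbb R^3)\ \forall k\in\mathbb N\}$, where $L^1_k$ is the $L^1$ space with weight $(1+|\mathbf v|^2)^{k/2}$. For $N$ odd, $P_N(z_1,z_2)=(z_1^{1/N}+z_2^{1/N}-1)^N$ for $z_1,z_2\in\mathbb R$ (with $z^{1/N}=-|z|^{1/N}$ for $z<0$), and for $f\in\mathscr D(\mathcal C)$ $$\mathcal C_N(f)(\mathbf v)=\int_{\mathbb R^3}\int_{\mathbb S^2}B\,MM_*\left[P_N\left(\tfrac{\acute f}{\acute M},\tfrac{\acute f_*}{\acute M_*}\right)-P_N\left(\tfrac{f}{M},\tfrac{f_*}{M_*}\right)\right]d\boldsymbol\sigma\,d\mathbf v_*.$$ *)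

(* Defs.v *)
From HB Require Import structures.
From mathcomp Require Import all_boot all_order all_algebra.
From mathcomp Require Import all_classical all_reals all_analysis.
From mathcomp Require Import measurable_realfun.

Set Implicit Arguments.
Unset Strict Implicit.
Unset Printing Implicit Defensive.

Import Order.TTheory GRing.Theory Num.Theory.
Import numFieldNormedType.Exports.

Local Open Scope classical_set_scope.
Local Open Scope ring_scope.

(* Matrices carry the sigma-algebra generated by their entries; for 'cV[R]_3
   over a realType R this is the Borel sigma-algebra of R^3. *)
Definition measure_matrix_display : measure_display -> measure_display.
Proof. exact. Qed.

Definition matrix_measurable d (T : sigmaRingType d) (m n : nat) :
    set (set 'M[T]_(m, n)) :=
  <<s \bigcup_(ij in [set: 'I_m * 'I_n])
        preimage_set_system setT (fun A : 'M[T]_(m, n) => A ij.1 ij.2)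
          measurable >>.

Section matrix_measurable_structure.
Context d (T : sigmaRingType d) (m n : nat).

Let matrix_set0 : @matrix_measurable d T m n set0.
Proof. exact: sigma_algebra0. Qed.

Let matrix_setC (A : set 'M[T]_(m, n)) :
  matrix_measurable A -> matrix_measurable (~` A).
Proof. exact: sigma_algebraC. Qed.

Let matrix_bigcup (F : (set 'M[T]_(m, n))^nat) :
  (forall i, matrix_measurable (F i)) -> matrix_measurable (\bigcup_i F i).
Proof. exact: sigma_algebra_bigcup. Qed.

HB.instance Definition _ := @isMeasurable.Build (measure_matrix_display d)
  'M[T]_(m, n) (@matrix_measurable d T m n) matrix_set0 matrix_setC
  matrix_bigcup.

End matrix_measurable_structure.

Lemma measurable_entry d (T : sigmaRingType d) m n (i : 'I_m) (j : 'I_n) :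
  measurable_fun [set: 'M[T]_(m, n)] (fun A : 'M[T]_(m, n) => A i j).
Proof.
move=> _ Y mY; rewrite setTI; apply: sub_sigma_algebra.
by exists (i, j) => //; exists Y => //; rewrite setTI.
Qed.

Lemma measurable_fun_matrixP d1 d2 (T1 : measurableType d1)
    (T2 : measurableType d2) m n (f : T1 -> 'M[T2]_(m, n)) :
  measurable_fun setT f <->
  forall i j, measurable_fun setT (fun x => f x i j).
Proof.
split=> [mf i j|mf].
  exact: (measurableT_comp (@measurable_entry _ _ _ _ i j)).
move=> _ A mA; rewrite setTI.
pose G : set (set 'M[T2]_(m, n)) := [set B | measurable (f @^-1` B)].
suff : @matrix_measurable _ T2 m n `<=` G by exact.
apply: smallest_sub.
  split.
  - by rewrite /G/= preimage_set0.
  - move=> B mB; rewrite setTD /G/= -preimage_setC.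
    by apply: measurableC; exact: mB.
  - by move=> F mF; rewrite /G/= preimage_bigcup; apply: bigcup_measurable => k _; exact: mF.
move=> _ [[i j] _ [B mB <-]]; rewrite /G/= setTI.
by have := mf i j measurableT B mB; rewrite setTI.
Qed.

Lemma pushforward_sigma_additive d1 d2 (T1 : measurableType d1)
    (T2 : measurableType d2) (R : realFieldType)
    (mu : {measure set T1 -> \bar R}) (f : T1 -> T2) :
  measurable_fun setT f -> semi_sigma_additive (pushforward mu f).
Proof.
move=> mf; exact: (@measure_semi_sigma_additive _ _ _
  (measure_function_pushforward__canonical__measure_function_Measure mu mf)).
Qed.

Section euclidean_space.
Context {R : realType}.
Implicit Types v w s : 'cV[R]_3.

Definition dot v w : R := \sum_(i < 3) v i 0 * w i 0.

(* The Euclidean norm; MathComp-Analysis' `|v| on matrices is the sup norm. *)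
Definition enorm v : R := Num.sqrt (dot v v).

(* v / |v|, which is 0 for v = 0. *)
Definition unit_dir v : 'cV[R]_3 := (enorm v)^-1 *: v.

Lemma dot_ge0 v : 0 <= dot v v.
Proof. by apply: sumr_ge0 => i _; rewrite -expr2 sqr_ge0. Qed.

Lemma measurable_enorm : measurable_fun setT enorm.
Proof.
rewrite (_ : enorm = fun v => dot v v `^ 2^-1); last first.
  by apply/funext => v; rewrite powR12_sqrt// dot_ge0.
apply: (measurableT_comp (measurable_powR _)).
by apply: measurable_sum => i; apply: measurable_funM; exact: measurable_entry.
Qed.

Lemma measurable_unit_dir : measurable_fun setT unit_dir.
Proof.
apply/measurable_fun_matrixP => i j.
rewrite (_ : (fun _ => _) = fun v => enorm v `^ (-1) * v i j); last first.
  by apply/funext => v; rewrite mxE powR_inv1// sqrtr_ge0.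
apply: measurable_funM; last exact: measurable_entry.
exact: measurableT_comp (measurable_powR _) measurable_enorm.
Qed.

Definition vec3 (x : measurableTypeR R * measurableTypeR R * measurableTypeR R) :
    'cV[R]_3 :=
  \col_(i < 3) [:: x.1.1; x.1.2; x.2]`_i.

Lemma measurable_vec3 : measurable_fun setT vec3.
Proof.
apply/measurable_fun_matrixP => i j.
case: i => -[|[|[|//]]] p; under eq_fun do rewrite mxE /=.
- exact: measurableT_comp measurable_fst measurable_fst.
- exact: measurableT_comp measurable_snd measurable_fst.
- exact: measurable_snd.
Qed.

Definition lebesgue3 : set 'cV[R]_3 -> \bar R :=
  pushforward
    (lebesgue_measure \x lebesgue_measure \x lebesgue_measure)%E vec3.

Let lebesgue3_0 : lebesgue3 set0 = 0%E.
Proof. by rewrite /lebesgue3 /pushforward preimage_set0 measure0. Qed.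

Let lebesgue3_ge0 A : (0 <= lebesgue3 A)%E.
Proof. by rewrite /lebesgue3 /pushforward; exact: measure_ge0. Qed.

Let lebesgue3_sigma_additive : semi_sigma_additive lebesgue3.
Proof.
have h := @pushforward_sigma_additive _ _ _ _ _
  (@lebesgue_measure R \x @lebesgue_measure R \x @lebesgue_measure R)%E
  _ measurable_vec3.
exact h.
Qed.

HB.instance Definition _ := isMeasure.Build _ _ _ lebesgue3
  lebesgue3_0 lebesgue3_ge0 lebesgue3_sigma_additive.

Definition sphere : set 'cV[R]_3 := [set s | enorm s = 1].

Definition punctured_ball : set 'cV[R]_3 := [set x | 0 < enorm x <= 1].

Lemma measurable_punctured_ball : measurable punctured_ball.
Proof.
rewrite (_ : punctured_ball = enorm @^-1` `]0, 1]); last first.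
  by apply/seteqP; split => x /=; rewrite in_itv.
by rewrite -[X in measurable X]setTI; exact: measurable_enorm.
Qed.

(* Surface measure of the unit sphere: the measure of a subset A of the sphere
   is 3 times the volume of the cone {r s | 0 < r <= 1, s in A}, so that
   dx = r^2 dr dsigma in polar coordinates x = r s; total mass 4 pi. As a
   measure on R^3 it is concentrated on the sphere. *)
Definition surface : set 'cV[R]_3 -> \bar R :=
  pushforward (mscale 3%:nng (mrestr lebesgue3 measurable_punctured_ball))
    unit_dir.

Let surface0 : surface set0 = 0%E.
Proof. by rewrite /surface /pushforward preimage_set0 measure0. Qed.

Let surface_ge0 A : (0 <= surface A)%E.
Proof. by rewrite /surface /pushforward; exact: measure_ge0. Qed.

Let surface_sigma_additive : semi_sigma_additive surface.
Proof.
have h := @pushforward_sigma_additive _ _ _ _ _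
  (mscale 3%:nng (mrestr lebesgue3 measurable_punctured_ball))
  _ measurable_unit_dir.
exact: h.
Qed.

HB.instance Definition _ := isMeasure.Build _ _ _ surface
  surface0 surface_ge0 surface_sigma_additive.

End euclidean_space.

Section collision_operators.
Context {R : realType}.
Implicit Types (f : 'cV[R]_3 -> R) (v w s : 'cV[R]_3).

(* Fixed Maxwellian and collision kernel; b is given on R but is only used on
   [-1, 1]. *)
Variables (rho theta : R) (u : 'cV[R]_3) (gamma : R) (b : R -> R).

Definition maxwellian v : R :=
  rho / (2 * pi * theta) `^ (3 / 2) *
  expR (- (enorm (v - u) ^+ 2 / (2 * theta))).

(* At v = w, a null set of w for each v, the relative direction is not defined
   and the value is 0 `^ gamma * b 0. *)
Definition collision_kernel v w s : R :=
  enorm (v - w) `^ gamma * b (dot (unit_dir (v - w)) s).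

Definition post v w s : 'cV[R]_3 :=
  2^-1 *: (v + w) + (2^-1 * enorm (v - w)) *: s.

Definition post_star v w s : 'cV[R]_3 :=
  2^-1 *: (v + w) - (2^-1 * enorm (v - w)) *: s.

Definition boltzmann f v : \bar R :=
  \int[lebesgue3]_w \int[surface]_(s in sphere)
    (collision_kernel v w s *
       (f (post v w s) * f (post_star v w s) - f v * f w))%:E.

Definition weighted_L1 (k : nat) : set ('cV[R]_3 -> \bar R) :=
  [set h | lebesgue3.-integrable setT
             (fun v => ((1 + enorm v ^+ 2) `^ (k%:R / 2))%:E * h v)%E].

Definition collision_domain : set ('cV[R]_3 -> R) :=
  [set f | weighted_L1 2 (EFin \o f) /\
           forall k : nat, weighted_L1 k (boltzmann f)].

(* The real N-th root, for N odd. *)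
Definition odd_root (N : nat) (z : R) : R := Num.sg z * `|z| `^ N%:R^-1.

Definition approx_prod (N : nat) (z1 z2 : R) : R :=
  (odd_root N z1 + odd_root N z2 - 1) ^+ N.

Definition approx_collision (N : nat) f v : \bar R :=
  \int[lebesgue3]_w \int[surface]_(s in sphere)
    (collision_kernel v w s * (maxwellian v * maxwellian w) *
       (approx_prod N
          (f (post v w s) / maxwellian (post v w s))
          (f (post_star v w s) / maxwellian (post_star v w s))
        - approx_prod N (f v / maxwellian v) (f w / maxwellian w)))%:E.

End collision_operators.

(* The codomain is arbitrary: collision terms are \bar R-valued. *)
Section rotations.
Context {R : realType} {X : Type}.
Implicit Types (u v : 'cV[R]_3) (O : 'M[R]_3) (f : 'cV[R]_3 -> X).

Definition translate u f : 'cV[R]_3 -> X := fun v => f (v + u).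

Definition rotate O f : 'cV[R]_3 -> X := fun v => f (O^T *m v).

Definition rotate_about u O f : 'cV[R]_3 -> X :=
  (translate (- u) \o rotate O \o translate u) f.

End rotations.

Definition orthogonal_mx (R : realType) (O : 'M[R]_3) : Prop :=
  O^T *m O = 1%:M.

(* Main.v *)
From mathcomp Require Import all_boot all_order all_algebra lra.
From HB Require Import structures.
Require Import Defs.
From mathcomp Require Import all_classical all_reals all_analysis.
From mathcomp Require Import measurable_realfun.

Set Implicit Arguments.
Unset Strict Implicit.
Unset Printing Implicit Defensive.

Import Order.TTheory GRing.Theory Num.Theory.
Import numFieldNormedType.Exports.

Local Open Scope classical_set_scope.
Local Open Scope ring_scope.

(** The operator T is composition with the rigid motion
    phi v = O^T (v - u) + u, which fixes u.  Substituting phi w for w and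
    O^T s for s in the collision integral at the point phi v turns it into the
    collision integral at v of the composed function: |v - w| and
    (v - w) . s are unchanged, both post-collisional velocities are mapped by
    phi, and M is radial around u, hence phi-invariant.  Thus approx_collision
    and boltzmann commute with T as soon as Lebesgue measure on R^3 is
    invariant under phi (lebesgue3_rotation_about) and the surface measure
    under O^T (surface_orthogonal).

    The substitution is made in nested integrals of arbitrary functions, for
    which the integral is a difference of suprema over simple functions; a
    bimeasurable, measure-preserving bijection permutes the simple functions
    without changing their integrals (integral_measure_automorphism).

    Invariance of Lebesgue measure mu under an orthogonal O is obtained
    without determinants, from the uniqueness argument for Haar measure.
    With B the unit ball, the double integral
      int int 1_A (x + O y) 1_B (O y) dx dy
    equals mu A * mu B when x is integrated first.  Shifting y by O^T x
    before exchanging the integrals gives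
      int int 1_A (O y) 1_B (O y - x) dx dy = mu (O^-1 A) * mu B.
    Only translation invariance, Tonelli and O^-1 B = B = - B are involved, and
    0 < mu B < +oo allows mu B to be cancelled (lebesgue3_preimage_mulmx).

    Finally the domain of the collision operator is T-invariant because
    boltzmann commutes with T and because the weights 1 + |v|^2 and
    1 + |phi v|^2 bound each other up to a constant depending on u
    (weight_rotation_about_le). *)

(** * Change of variables along measure automorphisms *)

(** The inverse is part of the data because the change of variables pulls
    simple functions back along it, and its measurability does not follow from
    that of phi. *)
Definition measure_automorphism d (T : measurableType d) (R : realType)
    (mu : set T -> \bar R) (phi psi : T -> T) :=
  [/\ cancel phi psi, cancel psi phi, measurable_fun setT phi,
      measurable_fun setT psi &
      forall A, measurable A -> mu (phi @^-1` A) = mu A].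

Section measure_automorphism_theory.
Context d (T : measurableType d) (R : realType).
Variable mu : {measure set T -> \bar R}.
Implicit Types phi psi : T -> T.

Lemma measure_automorphism_sym phi psi :
  measure_automorphism mu phi psi -> measure_automorphism mu psi phi.
Proof.
move=> [phiK psiK mphi mpsi muphi]; split => // A mA.
rewrite -muphi; last by rewrite -[X in measurable X]setTI; exact: mpsi.
by rewrite -comp_preimage (_ : psi \o phi = id)// funeqE => x /=; rewrite phiK.
Qed.

Lemma measure_automorphism_comp phi psi phi' psi' :
  measure_automorphism mu phi psi -> measure_automorphism mu phi' psi' ->
  measure_automorphism mu (phi \o phi') (psi' \o psi).
Proof.
move=> [phiK psiK mphi mpsi muphi] [phiK' psiK' mphi' mpsi' muphi'].
split.
- by move=> x /=; rewrite phiK phiK'.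
- by move=> x /=; rewrite psiK' psiK.
- exact: measurableT_comp.
- exact: measurableT_comp.
- move=> A mA; rewrite comp_preimage muphi' ?muphi//.
  by rewrite -[X in measurable X]setTI; exact: mphi.
Qed.

Import HBNNSimple.

(** A simple function below f pulls back to a simple function below
    f \o phi with the same integral. *)
Let ereal_sup_sintegral_le phi psi (f : T -> \bar R) :
  measure_automorphism mu phi psi ->
  (ereal_sup [set sintegral mu h |
     h in [set h : {nnsfun T >-> R} | forall x, ((h x)%:E <= f x)%E]] <=
   ereal_sup [set sintegral mu h |
     h in [set h : {nnsfun T >-> R} | forall x, ((h x)%:E <= f (phi x))%E]])%E.
Proof.
move=> [phiK psiK mphi mpsi muphi].
apply: ge_ereal_sup => _ [h /= hf <-]; apply: ereal_sup_ubound => /=.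
have mhphi : measurable_fun setT (h \o phi) by exact: measurableT_comp.
have fhphi : finite_set (range (h \o phi)).
  by apply: (sub_finite_set _ (fimfunP h)) => _ [x _ <-]; exists (phi x).
have hphi0 x : 0 <= (h \o phi) x by exact: fun_ge0.
pose hphi := HB.pack_for {nnsfun T >-> R} (h \o phi)
  (isMeasurableFun.Build _ _ _ _ _ mhphi)
  (FiniteImage.Build _ _ _ fhphi)
  (isNonNegFun.Build _ _ _ hphi0).
exists hphi; first by move=> x; exact: hf.
rewrite /sintegral; apply: eq_fsbigr => r _.
by rewrite -(muphi (h @^-1` [set r])).
Qed.

(** For arbitrary f and D, the integral is the difference of the suprema of the
    integrals of simple functions below the positive and the negative part, and
    both suprema are unchanged: the bound above is applied to phi and to psi. *)
Lemma integral_measure_automorphism phi psi (D : set T) (f : T -> \bar R) :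
  measure_automorphism mu phi psi ->
  (\int[mu]_(x in phi @^-1` D) f (phi x) = \int[mu]_(x in D) f x)%E.
Proof.
move=> phiP.
have phiV := measure_automorphism_sym phiP.
have [phiK psiK _ _ _] := phiP.
rewrite /integral.
have -> : (fun x => f (phi x)) \_ (phi @^-1` D) = (f \_ D) \o phi.
  apply/funext => x; rewrite /patch /=.
  by rewrite (_ : (x \in _) = (phi x \in D))//; apply/idP/idP; rewrite !inE.
have nnE (g : T -> \bar R) :
    ereal_sup [set sintegral mu h |
      h in [set h : {nnsfun T >-> R} | forall x, ((h x)%:E <= (g \o phi) x)%E]] =
    ereal_sup [set sintegral mu h |
      h in [set h : {nnsfun T >-> R} | forall x, ((h x)%:E <= g x)%E]].
  apply/eqP; rewrite eq_le; apply/andP; split; last first.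
    exact: ereal_sup_sintegral_le phiP.
  (* The same bound along psi, for which g is the pullback of g \o phi. *)
  have gE : g = (g \o phi) \o psi by apply/funext => x; rewrite /= psiK.
  by rewrite [in leRHS]gE; exact: ereal_sup_sintegral_le phiV.
by rewrite funepos_comp funeneg_comp !nnE.
Qed.

End measure_automorphism_theory.

Section measure_automorphism_prod.
Context d1 d2 (T1 : measurableType d1) (T2 : measurableType d2) (R : realType).
Variable m1 : {measure set T1 -> \bar R}.
Variable m2 : {sigma_finite_measure set T2 -> \bar R}.

(** The x-section of a preimage is the phi2-preimage of the section at phi1 x,
    so the change of variables applies to each of the two nested measures. *)
Lemma measure_automorphism_prod (phi1 psi1 : T1 -> T1) (phi2 psi2 : T2 -> T2) :
  measure_automorphism m1 phi1 psi1 -> measure_automorphism m2 phi2 psi2 ->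
  measure_automorphism (m1 \x m2)%E (fun x => (phi1 x.1, phi2 x.2))
    (fun x => (psi1 x.1, psi2 x.2)).
Proof.
move=> phi1P phi2P.
have [phi1K psi1K mphi1 mpsi1 _] := phi1P.
have [phi2K psi2K mphi2 mpsi2 m2phi2] := phi2P.
split.
- by case=> x y /=; rewrite phi1K phi2K.
- by case=> x y /=; rewrite psi1K psi2K.
- by apply: measurable_fun_pair; exact: measurableT_comp.
- by apply: measurable_fun_pair; exact: measurableT_comp.
- move=> A mA; rewrite /product_measure1.
  rewrite -[RHS](integral_measure_automorphism setT _ phi1P) preimage_setT.
  apply: eq_integral => x _ /=.
  rewrite -(m2phi2 (xsection A (phi1 x))); last exact: measurable_xsection.
  by congr (m2 _); apply/seteqP; split => y; rewrite /xsection /= !inE.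
Qed.

End measure_automorphism_prod.

(** * Lebesgue measure on R^3: boxes and translations *)

Section translations.
Context {R : realType}.

Lemma lebesgue_measure_translation (a : R) :
  measure_automorphism (@lebesgue_measure R)
    (fun x : measurableTypeR R => x + a) (fun x => x - a).
Proof.
have mD (c : R) :
    measurable_fun setT (fun x : measurableTypeR R => (x + c) : measurableTypeR R).
  by apply: measurable_funD.
split.
- by move=> x; rewrite addrK.
- by move=> x; rewrite subrK.
- exact: mD.
- exact: mD.
- move=> A mA; apply/esym.
  (* The shifted measure agrees with Lebesgue measure on half-open
     intervals. *)
  pose nu := measure_function_pushforward__canonical__measure_function_Measure
    (@lebesgue_measure R) (mD a).
  apply: (@lebesgue_measure_unique R nu) => // _ [[x y]] _ <- /=.
  rewrite /pushforward (_ : _ @^-1` _ = `]x - a, y - a]%classic).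
    rewrite !lebesgue_measure_itv/= !lte_fin ltrD2r.
    by rewrite -!EFinB (_ : y - a - (x - a) = y - x)// opprB addrA subrK.
  by apply/seteqP; split => t /=; rewrite !in_itv/= ltrBlDr lerBrDr.
Qed.

(** Cubes exhaust R^3, which gives sigma-finiteness, and two of them enclose
    the unit ball, which bounds its measure on both sides. *)
Definition box (a : R) : set 'cV[R]_3 := [set v | forall i, `|v i 0| <= a].

Lemma measurable_box a : measurable (box a).
Proof.
rewrite (_ : box a = \bigcap_(i in [set: 'I_3]) (fun v => v i 0) @^-1` `[- a, a]).
  apply: fin_bigcap_measurable => // i _; rewrite -[X in measurable X]setTI.
  exact: measurable_entry.
apply/seteqP; split => v /= va i; first by move=> _ /=; rewrite in_itv/= -ler_norml.
by have := va i I; rewrite /= in_itv/= -ler_norml.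
Qed.

Lemma lebesgue3_box (a : R) : 0 <= a ->
  lebesgue3 (box a) = (((a + a) * (a + a)) * (a + a))%:E.
Proof.
move=> a0; rewrite /lebesgue3 /pushforward.
rewrite (_ : _ @^-1` _ = (`[- a, a] `*` `[- a, a]) `*` `[- a, a]); last first.
  apply/seteqP; split => [[[x y] z]|[[x y] z] [[]]] /=.
    move=> va; have := va 0; have := va 1; have := va 2%:R.
    by rewrite /vec3 !mxE/= !in_itv/= !ler_norml.
  rewrite !in_itv/= -!ler_norml => xa ya za i.
  by rewrite /vec3 mxE; case: i => -[|[|[|//]]] p.
have mu_a : lebesgue_measure `[- a, a] = (a + a)%:E.
  rewrite lebesgue_measure_itv/= lte_fin -EFinB opprK.
  case: ltP => // aN; congr EFin; apply/eqP.
  by rewrite eq_le addr_ge0//= -lerBrDr sub0r aN.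
rewrite product_measure1E//; last exact: measurableX.
rewrite /= product_measure1E// mu_a !EFinM.
by congr (_ * _ * _)%E; exact: mu_a.
Qed.

Lemma lebesgue3_sigma_finite : sigma_finite setT (@lebesgue3 R).
Proof.
exists (fun n => box n%:R); last first.
  move=> n; split; first exact: measurable_box.
  by rewrite lebesgue3_box// ltry.
apply/esym; rewrite -subTset => v _.
pose M := \sum_(i < 3) `|v i 0|.
exists (Num.truncn M).+1 => //= i.
have M0 : 0 <= M by exact: sumr_ge0.
rewrite (le_trans _ (ltW (truncnS_gt _)))//.
by rewrite /M (bigD1 i)//= lerDl sumr_ge0.
Qed.

HB.instance Definition _ := Measure_isSigmaFinite.Build _ _ _ (@lebesgue3 R)
  lebesgue3_sigma_finite.

Lemma measurable_col_add d (T : measurableType d) (f g : T -> 'cV[R]_3) :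
  measurable_fun setT f -> measurable_fun setT g ->
  measurable_fun setT (fun x => f x + g x).
Proof.
move=> /measurable_fun_matrixP mf /measurable_fun_matrixP mg.
apply/measurable_fun_matrixP => i j; under eq_fun do rewrite mxE.
exact: measurable_funD.
Qed.

Lemma measurable_mulmx (O : 'M[R]_3) :
  measurable_fun setT (fun v : 'cV[R]_3 => O *m v).
Proof.
apply/measurable_fun_matrixP => i j; under eq_fun do rewrite mxE.
apply: measurable_sum => k; apply: measurable_funM => //.
exact: measurable_entry.
Qed.

Lemma lebesgue3_translation (a : 'cV[R]_3) :
  measure_automorphism (@lebesgue3 R) (fun v => v + a) (fun v => v - a).
Proof.
have mD c : measurable_fun setT (fun v : 'cV[R]_3 => v + c).
  exact: measurable_col_add.
split.
- by move=> v; rewrite addrK.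
- by move=> v; rewrite subrK.
- exact: mD.
- exact: mD.
- move=> A mA; rewrite /lebesgue3 /pushforward.
  have mA3 : measurable (@vec3 R @^-1` A).
    by rewrite -[X in measurable X]setTI; exact: measurable_vec3.
  have [_ _ _ _ mu3D] := measure_automorphism_prod
    (measure_automorphism_prod (lebesgue_measure_translation (a 0 0))
      (lebesgue_measure_translation (a 1 0)))
    (lebesgue_measure_translation (a 2%:R 0)).
  rewrite -[RHS](mu3D _ mA3) -comp_preimage -[in RHS]comp_preimage.
  rewrite (_ : (fun v => v + a) \o vec3 = vec3 \o
    (fun x => (x.1.1 + a 0 0, x.1.2 + a 1 0, x.2 + a 2%:R 0)))//.
  apply/funext => -[[x y] z] /=; apply/colP => i; rewrite !mxE.
  by case: i => -[|[|[|//]]] p /=; congr (_ + a _ _); apply/val_inj.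
Qed.

End translations.

(** * Orthogonal invariance of Lebesgue measure *)

Section orthogonal_invariance.
Context {R : realType}.
Implicit Types (O : 'M[R]_3) (v w : 'cV[R]_3).

Lemma dotE v w : dot v w = (v^T *m w) 0 0.
Proof. by rewrite mxE; apply: eq_bigr => i _; rewrite mxE. Qed.

Lemma orthogonal_mx_tr O : orthogonal_mx O -> orthogonal_mx O^T.
Proof. by rewrite /orthogonal_mx trmxK => /mulmx1C. Qed.

Lemma dot_mulmx O v w : orthogonal_mx O -> dot (O *m v) (O *m w) = dot v w.
Proof.
by move=> OO; rewrite !dotE trmx_mul mulmxA -(mulmxA v^T) OO mulmx1.
Qed.

Lemma enorm_mulmx O v : orthogonal_mx O -> enorm (O *m v) = enorm v.
Proof. by move=> OO; rewrite /enorm dot_mulmx. Qed.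

Lemma enormN v : enorm (- v) = enorm v.
Proof.
by rewrite /enorm /dot; congr Num.sqrt; apply: eq_bigr => i _; rewrite mxE mulrNN.
Qed.

Definition unit_ball : set 'cV[R]_3 := [set v | enorm v <= 1].

Lemma unit_ballE v : unit_ball v <-> dot v v <= 1.
Proof. by rewrite /unit_ball/= /enorm -[X in _ <= X]sqrtr1 ler_sqrt. Qed.

Lemma measurable_unit_ball : measurable unit_ball.
Proof.
rewrite (_ : unit_ball = enorm @^-1` `]-oo, 1]); last first.
  by apply/seteqP; split => x /=; rewrite in_itv.
by rewrite -[X in measurable X]setTI; exact: measurable_enorm.
Qed.

Lemma unit_ball_sub_box : unit_ball `<=` box 1.
Proof.
move=> v /unit_ballE v1 i; rewrite -(ler_pXn2r (n := 2))// ?nnegrE//.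
rewrite real_normK ?num_real// expr1n (le_trans _ v1)//.
rewrite /dot (bigD1 i)//= -expr2 lerDl.
by apply: sumr_ge0 => j _; rewrite -expr2 sqr_ge0.
Qed.

Lemma box_sub_unit_ball : box 2^-1 `<=` unit_ball.
Proof.
move=> v va; apply/unit_ballE.
apply: (@le_trans _ _ (\sum_(i < 3) 2^-1 ^+ 2)).
  apply: ler_sum => i _; rewrite -expr2 -real_normK ?num_real//.
  by rewrite ler_pXn2r ?nnegrE ?invr_ge0//; exact: va.
rewrite sumr_const card_ord -[leLHS]mulr_natl exprVn ler_pdivrMr ?exprn_gt0//.
by rewrite mul1r expr2 -natrM ler_nat.
Qed.

Lemma lebesgue3_unit_ball_gt0 : (0 < lebesgue3 unit_ball)%E.
Proof.
apply: (@lt_le_trans _ _ (lebesgue3 (box (2^-1 : R)))).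
  by rewrite lebesgue3_box// lte_fin !mulr_gt0// addr_gt0.
apply: le_measure; rewrite ?inE; [exact: measurable_box| |].
  exact: measurable_unit_ball.
exact: box_sub_unit_ball.
Qed.

Lemma lebesgue3_unit_ball_fin_num : lebesgue3 unit_ball \is a fin_num.
Proof.
rewrite ge0_fin_numE//.
apply: (@le_lt_trans _ _ (lebesgue3 (box (1 : R)))); last first.
  by rewrite lebesgue3_box// ltry.
apply: le_measure; rewrite ?inE; [|exact: measurable_box|].
  exact: measurable_unit_ball.
exact: unit_ball_sub_box.
Qed.

End orthogonal_invariance.

Lemma mule_cancell (R : realDomainType) (x y z : \bar R) :
  x \is a fin_num -> (0 < x)%E -> (x * y = x * z)%E -> y = z.
Proof.
move=> xfin x0 xyz; apply/eqP; rewrite eq_le.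
by apply/andP; split; rewrite -(lee_pmul2l xfin x0) xyz.
Qed.

(** Tonelli for a set whose horizontal sections over B all have the same
    measure c and are null elsewhere. *)
Lemma tonelli_sections d1 d2 (T1 : measurableType d1) (T2 : measurableType d2)
    (R : realType) (m1 : {sigma_finite_measure set T1 -> \bar R})
    (m2 : {sigma_finite_measure set T2 -> \bar R}) (E : set (T1 * T2))
    (B : set T2) (c : \bar R) :
  measurable E -> measurable B -> (0 <= c)%E ->
  (forall y, m1 (ysection E y) = c * (\1_B y)%:E)%E ->
  (\int[m1]_x m2 (xsection E x) = c * m2 B)%E.
Proof.
move=> mE mB c0 Ec.
have := indic_fubini_tonelli m1 m2 mE.
rewrite indic_fubini_tonelli_FE// indic_fubini_tonelli_GE// => ->.
rewrite (_ : m1 \o _ = fun y => c * (\1_B y)%:E)%E; last exact/funext.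
by rewrite ge0_integralZl ?integral_indic ?setIT//; exact: measurableT_comp.
Qed.

Section orthogonal_lebesgue.
Context {R : realType}.
Implicit Types (O : 'M[R]_3) (A : set 'cV[R]_3).

(** The Haar uniqueness argument: each x-section of E2 is the preimage of the
    x-section of E1 under y |-> y - O^T x, so that E1 and E2 have the same
    product measure.  Measured by horizontal sections, E1 gives mu A * mu B and
    E2 gives mu B * mu (O^-1 A). *)
Lemma lebesgue3_preimage_mulmx O A : orthogonal_mx O -> measurable A ->
  lebesgue3 (mulmx O @^-1` A) = lebesgue3 A.
Proof.
move=> OO mA.
have OOT : O *m O^T = 1%:M by exact: mulmx1C.
have mO : measurable_fun setT (mulmx O : 'cV[R]_3 -> _) by exact: measurable_mulmx.
have mOA : measurable (mulmx O @^-1` A).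
  by rewrite -[X in measurable X]setTI; exact: mO.
set B := @unit_ball R; have mB : measurable B := measurable_unit_ball.
have OB : mulmx O @^-1` B = B.
  by apply/seteqP; split => v; rewrite /B /unit_ball/= enorm_mulmx.
pose E1 := [set z : 'cV[R]_3 * 'cV[R]_3 | A (z.1 + O *m z.2) /\ B (O *m z.2)].
pose E2 := [set z : 'cV[R]_3 * 'cV[R]_3 | A (O *m z.2) /\ B (z.1 - O *m z.2)].
have mOsnd : measurable_fun setT (fun z : 'cV[R]_3 * 'cV[R]_3 => O *m z.2).
  exact: measurableT_comp.
have mE1 : measurable E1.
  rewrite (_ : E1 = (fun z => z.1 + O *m z.2) @^-1` A `&`
    (fun z => O *m z.2) @^-1` B)//.
  apply: measurableI; rewrite -[X in measurable X]setTI; last exact: mOsnd.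
  by apply: measurable_col_add.
have mE2 : measurable E2.
  rewrite (_ : E2 = (fun z => O *m z.2) @^-1` A `&`
    (fun z => z.1 + (- O) *m z.2) @^-1` B); last first.
    by apply/seteqP; split => z; rewrite /E2/= mulNmx.
  apply: measurableI; rewrite -[X in measurable X]setTI; first exact: mOsnd.
  apply: measurable_col_add => //.
  by apply: (measurableT_comp (measurable_mulmx _)).
have E1E : (\int[lebesgue3]_x lebesgue3 (xsection E1 x) =
            lebesgue3 A * lebesgue3 B)%E.
  apply: tonelli_sections => // y.
  rewrite indicE; have [By|By] := boolP (y \in B).
    have [_ _ _ _ <-//] := lebesgue3_translation (O *m y).
    rewrite mule1; congr lebesgue3; apply/seteqP; split => x.
      by rewrite /ysection /= inE => -[].
    move=> Ax; rewrite /ysection /= inE; split=> //.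
    by rewrite -OB in By; rewrite inE in By.
  rewrite mule0 (_ : ysection _ _ = set0) ?measure0//.
  apply/seteqP; split => // x; rewrite /ysection/= inE => -[_ By'].
  by move/negP: By; apply; rewrite inE -OB.
have E2E : (\int[lebesgue3]_x lebesgue3 (xsection E2 x) =
            lebesgue3 B * lebesgue3 (mulmx O @^-1` A))%E.
  apply: tonelli_sections => // y.
  rewrite indicE; have [Ay|Ay] := boolP (y \in mulmx O @^-1` A).
    have [_ _ _ _ <-//] := lebesgue3_translation (- (O *m y)).
    rewrite mule1; congr lebesgue3; apply/seteqP; split => x.
      by rewrite /ysection /= inE => -[].
    by move=> Bx; rewrite /ysection /= inE; split=> //; rewrite inE in Ay.
  rewrite mule0 (_ : ysection _ _ = set0) ?measure0//.
  apply/seteqP; split => // x; rewrite /ysection/= inE => -[Ay' _].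
  by move/negP: Ay; apply; rewrite inE.
have E12 : (\int[lebesgue3]_x lebesgue3 (xsection E1 x) =
            \int[lebesgue3]_x lebesgue3 (xsection E2 x))%E.
  apply: eq_integral => x _.
  have [_ _ _ _ trE] := lebesgue3_translation (- (O^T *m x)).
  rewrite -[LHS](trE _ (measurable_xsection x mE1)).
  congr lebesgue3; apply/seteqP; split => y; rewrite /xsection/= !inE /E1 /E2/=.
    rewrite mulmxDr mulmxN mulmxA OOT mul1mx addrC subrK => -[Ay By].
    by split => //; rewrite /B /unit_ball/= -enormN opprB.
  move=> [Ay By]; rewrite mulmxDr mulmxN mulmxA OOT mul1mx addrC subrK.
  by split => //; rewrite /B /unit_ball/= -enormN opprB.
(* Cancel the measure of the ball, which is positive and finite. *)
have BA : (lebesgue3 B * lebesgue3 A =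
    lebesgue3 B * lebesgue3 (mulmx O @^-1` A))%E.
  by rewrite muleC; exact: etrans (esym E1E) (etrans E12 E2E).
exact: esym (mule_cancell lebesgue3_unit_ball_fin_num lebesgue3_unit_ball_gt0 BA).
Qed.

Lemma lebesgue3_orthogonal O : orthogonal_mx O ->
  measure_automorphism (@lebesgue3 R) (mulmx O) (mulmx O^T).
Proof.
move=> OO; split.
- by move=> v; rewrite mulmxA OO mul1mx.
- by move=> v; rewrite mulmxA (mulmx1C OO) mul1mx.
- exact: measurable_mulmx.
- exact: measurable_mulmx.
- by move=> A mA; exact: lebesgue3_preimage_mulmx.
Qed.

End orthogonal_lebesgue.

(** * Rigid motions and the collision operators *)

Section rigid_motions.
Context {R : realType}.
Implicit Types (O : 'M[R]_3) (u v w s : 'cV[R]_3).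

Lemma unit_dir_mulmx O v : orthogonal_mx O -> unit_dir (O *m v) = O *m unit_dir v.
Proof. by move=> OO; rewrite /unit_dir enorm_mulmx// -scalemxAr. Qed.

(** The cone over the preimage of A is the preimage of the cone over A, since
    O commutes with the radial projection and preserves the punctured ball. *)
Lemma surface_orthogonal O : orthogonal_mx O ->
  measure_automorphism (@surface R) (mulmx O) (mulmx O^T).
Proof.
move=> OO; have [OK OVK mO mOV muO] := lebesgue3_orthogonal OO.
split => // A mA.
rewrite /surface /pushforward /mscale/= /mrestr; congr (_ * _)%E.
have mE : measurable (@unit_dir R @^-1` A `&` punctured_ball).
  apply: measurableI; last exact: measurable_punctured_ball.
  by rewrite -[X in measurable X]setTI; exact: measurable_unit_dir.
rewrite -[RHS](muO _ mE); congr lebesgue3.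
by apply/seteqP; split => v; rewrite /punctured_ball/= unit_dir_mulmx// enorm_mulmx.
Qed.

Definition rotation_about u O v : 'cV[R]_3 := O^T *m (v - u) + u.

Lemma rotate_aboutE (X : Type) u O (f : 'cV[R]_3 -> X) :
  rotate_about u O f = f \o rotation_about u O.
Proof. by []. Qed.

Lemma rotation_aboutK u O : orthogonal_mx O ->
  cancel (rotation_about u O) (rotation_about u O^T).
Proof.
move=> OO v; rewrite /rotation_about addrK trmxK mulmxA (mulmx1C OO) mul1mx.
by rewrite subrK.
Qed.

Lemma lebesgue3_rotation_about u O : orthogonal_mx O ->
  measure_automorphism (@lebesgue3 R) (rotation_about u O) (rotation_about u O^T).
Proof.
move=> OO.
have h := measure_automorphism_comp (lebesgue3_translation u)
  (measure_automorphism_comp (lebesgue3_orthogonal (orthogonal_mx_tr OO))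
    (lebesgue3_translation (- u))).
by rewrite opprK in h; exact: h.
Qed.

Lemma rotation_aboutB u O v w :
  rotation_about u O v - rotation_about u O w = O^T *m (v - w).
Proof.
rewrite /rotation_about opprD addrACA subrr addr0 -mulmxBr.
by rewrite opprB addrA subrK.
Qed.

Lemma rotation_aboutD u O v w :
  rotation_about u O (v + w) = rotation_about u O v + O^T *m w.
Proof. by rewrite /rotation_about addrAC mulmxDr addrAC. Qed.

Lemma rotation_about_midpoint u O v w :
  rotation_about u O (2^-1 *: (v + w)) =
  2^-1 *: (rotation_about u O v + rotation_about u O w).
Proof.
have halfD x : 2^-1 *: (x + x) = x :> 'cV[R]_3.
  by rewrite scalerDr -scalerDl -[2^-1]mul1r -splitr scale1r.
rewrite /rotation_about addrACA [in RHS]scalerDr halfD -mulmxDr addrACA.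
by rewrite scalemxAr -opprD scalerBr halfD.
Qed.

Lemma collision_kernel_rotation_about gamma b u O v w s : orthogonal_mx O ->
  collision_kernel gamma b (rotation_about u O v) (rotation_about u O w)
    (O^T *m s) = collision_kernel gamma b v w s.
Proof.
move=> /orthogonal_mx_tr OO; rewrite /collision_kernel rotation_aboutB.
by rewrite enorm_mulmx// unit_dir_mulmx// dot_mulmx.
Qed.

Lemma post_rotation_about u O v w s : orthogonal_mx O ->
  post (rotation_about u O v) (rotation_about u O w) (O^T *m s) =
  rotation_about u O (post v w s).
Proof.
move=> /orthogonal_mx_tr OO; rewrite /post rotation_aboutB enorm_mulmx//.
by rewrite rotation_aboutD rotation_about_midpoint scalemxAr.
Qed.

Lemma post_star_rotation_about u O v w s : orthogonal_mx O ->
  post_star (rotation_about u O v) (rotation_about u O w) (O^T *m s) =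
  rotation_about u O (post_star v w s).
Proof.
move=> /orthogonal_mx_tr OO; rewrite /post_star rotation_aboutB enorm_mulmx//.
by rewrite rotation_aboutD rotation_about_midpoint mulmxN scalemxAr.
Qed.

Lemma maxwellian_rotation_about rho theta u O v : orthogonal_mx O ->
  maxwellian rho theta u (rotation_about u O v) = maxwellian rho theta u v.
Proof.
move=> /orthogonal_mx_tr OO.
by rewrite /maxwellian /rotation_about addrK enorm_mulmx.
Qed.

(** The substitution behind both collision operators, for the integrand Q at a
    fixed first velocity; the sphere is its own preimage under O^T. *)
Lemma collision_integral_rotation_about u O (Q : 'cV[R]_3 -> 'cV[R]_3 -> \bar R) :
  orthogonal_mx O ->
  (\int[lebesgue3]_w \int[surface]_(s in sphere)
     Q (rotation_about u O w) (O^T *m s) =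
   \int[lebesgue3]_w \int[surface]_(s in sphere) Q w s)%E.
Proof.
move=> OO.
rewrite -[RHS](integral_measure_automorphism setT _
  (lebesgue3_rotation_about u OO)) preimage_setT.
apply: eq_integral => w _.
have OTO := orthogonal_mx_tr OO.
rewrite -[RHS](integral_measure_automorphism _ _ (surface_orthogonal OTO)).
congr (integral _ _ _).
by apply/seteqP; split => s; rewrite /sphere/= enorm_mulmx.
Qed.

Lemma boltzmann_rotation_about gamma b u O f : orthogonal_mx O ->
  boltzmann gamma b (f \o rotation_about u O) =
  boltzmann gamma b f \o rotation_about u O.
Proof.
move=> OO; apply/funext => v; rewrite /boltzmann/=.
rewrite -[RHS](collision_integral_rotation_about u _ OO).
apply: eq_integral => w _; apply: eq_integral => s _.
rewrite /= (collision_kernel_rotation_about _ _ u v w s OO).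
by rewrite (post_rotation_about u v w s OO) (post_star_rotation_about u v w s OO).
Qed.

Lemma approx_collision_rotation_about rho theta gamma b N u O f :
  orthogonal_mx O ->
  approx_collision rho theta u gamma b N (f \o rotation_about u O) =
  approx_collision rho theta u gamma b N f \o rotation_about u O.
Proof.
move=> OO; apply/funext => v; rewrite /approx_collision/=.
rewrite -[RHS](collision_integral_rotation_about u _ OO).
apply: eq_integral => w _; apply: eq_integral => s _.
have ME := maxwellian_rotation_about rho theta u _ OO.
rewrite /= (collision_kernel_rotation_about _ _ u v w s OO).
rewrite (post_rotation_about u v w s OO) (post_star_rotation_about u v w s OO).
by rewrite (ME v) (ME w) (ME (post v w s)) (ME (post_star v w s)).
Qed.

End rigid_motions.

(** * The domain of the collision operator *)

Section weights.
Context {R : realType}.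
Implicit Types (O : 'M[R]_3) (u v w : 'cV[R]_3).

Lemma sqr_enorm v : enorm v ^+ 2 = dot v v.
Proof. by rewrite /enorm sqr_sqrtr// dot_ge0. Qed.

(** From |v + w|^2 + |v - w|^2 = 2 (|v|^2 + |w|^2). *)
Lemma sqr_enormD_le v w :
  enorm (v + w) ^+ 2 <= 2 * (enorm v ^+ 2 + enorm w ^+ 2).
Proof.
rewrite !sqr_enorm /dot -big_split mulr_sumr; apply: ler_sum => i _ /=.
rewrite mxE -!expr2 -subr_ge0.
by have := sqr_ge0 (v i 0 - w i 0); lra.
Qed.

Definition weight (k : nat) v : R := (1 + enorm v ^+ 2) `^ (k%:R / 2).

Lemma weight_base_gt0 v : 0 < 1 + enorm v ^+ 2.
Proof. by rewrite ltr_pwDl// sqr_ge0. Qed.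

Lemma weight_gt0 k v : 0 < weight k v.
Proof. by rewrite powR_gt0// weight_base_gt0. Qed.

Lemma measurable_weight k : measurable_fun setT (weight k).
Proof.
apply: (measurableT_comp (measurable_powR _)).
by apply: measurable_funD => //; apply: measurable_funX; exact: measurable_enorm.
Qed.

(** The constant comes from v = O (phi v - u) + u and two uses of
    sqr_enormD_le: |v|^2 <= 2 (2 (|phi v|^2 + |u|^2) + |u|^2), hence
    1 + |v|^2 <= (4 + 6 |u|^2) (1 + |phi v|^2). *)
Lemma weight_rotation_about_le k u O v : orthogonal_mx O ->
  weight k v <= (4 + 6 * enorm u ^+ 2) `^ (k%:R / 2) *
    weight k (rotation_about u O v).
Proof.
move=> OO; rewrite /weight.
have C_gt0 : 0 < 4 + 6 * enorm u ^+ 2 by have := sqr_ge0 (enorm u); lra.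
rewrite -powRM ?(ltW C_gt0) ?(ltW (weight_base_gt0 _))//.
apply: ge0_ler_powR.
- by rewrite divr_ge0.
- by rewrite nnegrE ltW// weight_base_gt0.
- by rewrite nnegrE ltW// mulr_gt0// weight_base_gt0.
set v' := rotation_about u O v.
have v_v' : enorm v ^+ 2 <= 4 * enorm v' ^+ 2 + 6 * enorm u ^+ 2.
  have -> : v = rotation_about u O^T v' by rewrite rotation_aboutK.
  apply: le_trans (sqr_enormD_le _ _) _; rewrite trmxK enorm_mulmx//.
  have := sqr_enormD_le v' (- u); rewrite enormN.
  move: (enorm (v' - u) ^+ 2) (enorm v' ^+ 2) (enorm u ^+ 2) => a b c abc.
  by lra.
move: (enorm v ^+ 2) (enorm v' ^+ 2) (enorm u ^+ 2) v_v' (sqr_ge0 (enorm v'))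
  (sqr_ge0 (enorm u)) => a b c abc b0 c0.
by have := mulr_ge0 b0 c0; lra.
Qed.

(** Composition with phi keeps weight * h integrable, and changes the weight
    by a bounded factor. *)
Lemma weighted_L1_comp k u O (h : 'cV[R]_3 -> \bar R) : orthogonal_mx O ->
  weighted_L1 k h -> weighted_L1 k (h \o rotation_about u O).
Proof.
move=> OO; rewrite /weighted_L1/= -/(weight k) => /integrableP[mwh wh_fin].
have phiP := lebesgue3_rotation_about u OO.
have [_ _ mphi _ _] := phiP.
set phi := rotation_about u O in phiP mphi *.
set wh := fun v => ((weight k v)%:E * h v)%E in mwh wh_fin.
set C := (4 + 6 * enorm u ^+ 2) `^ (k%:R / 2).
have C_ge0 : 0 <= C by exact: powR_ge0.
have whphi : lebesgue3.-integrable setT (wh \o phi).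
  apply/integrableP; split; first exact: measurableT_comp.
  rewrite -(integral_measure_automorphism setT _ phiP) preimage_setT in wh_fin.
  exact: wh_fin.
have mwphi : measurable_fun setT (weight k \o phi).
  by apply: measurableT_comp => //; exact: measurable_weight.
(* Reduces measurability of weight * (h \o phi) to that of weight * h, by
   composition with phi and multiplication by a ratio of weights. *)
have whphiE v : ((weight k v)%:E * h (phi v) =
    (weight k v * (weight k (phi v)) `^ (-1))%:E * wh (phi v))%E.
  rewrite /wh muleA -EFinM powR_inv1 ?ltW ?weight_gt0// -mulrA mulVf ?mulr1//.
  by rewrite gt_eqF ?weight_gt0.
apply: (@le_integrable _ _ _ _ _ measurableT _ (fun v => C%:E * wh (phi v))%E).
- under eq_fun do rewrite whphiE.
  apply: emeasurable_funM; last exact: measurable_int whphi.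
  apply/measurable_EFinP; apply: measurable_funM; first exact: measurable_weight.
  exact: (measurableT_comp (measurable_powR _)).
- move=> v _; rewrite /wh !abseM muleA; apply: lee_pmul => //.
  rewrite /= lee_fin -/(weight k v) (ger0_norm C_ge0).
  rewrite (ger0_norm (ltW (weight_gt0 k v))) (ger0_norm (ltW (weight_gt0 k _))).
  exact: weight_rotation_about_le.
- exact: integrableZl.
Qed.

Lemma weighted_L1_rotation_about k u O (h : 'cV[R]_3 -> \bar R) :
  orthogonal_mx O ->
  weighted_L1 k (h \o rotation_about u O) <-> weighted_L1 k h.
Proof.
move=> OO; split; last exact: weighted_L1_comp.
move=> /(weighted_L1_comp u (orthogonal_mx_tr OO)).
rewrite -compA (_ : _ \o rotation_about u O^T = id)//.
apply/funext => v /=.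
by have := rotation_aboutK u (orthogonal_mx_tr OO) v; rewrite trmxK.
Qed.

Lemma collision_domain_rotation_about gamma b u O (f : 'cV[R]_3 -> R) :
  orthogonal_mx O ->
  collision_domain gamma b (f \o rotation_about u O) <->
  collision_domain gamma b f.
Proof.
move=> OO; rewrite /collision_domain/= boltzmann_rotation_about//.
split => -[f2 fk]; split.
- exact/(weighted_L1_rotation_about _ u _ OO).
- by move=> k; exact/(weighted_L1_rotation_about _ u _ OO).
- exact/(weighted_L1_rotation_about 2 u (EFin \o f) OO).
- by move=> k; exact/weighted_L1_rotation_about.
Qed.

End weights.

Theorem theorem2 (R : realType) (rho theta : R) (u : 'cV[R]_3)
    (gamma : R) (b : R -> R) (N : nat) (O : 'M[R]_3)
    (rho_gt0 : 0 < rho) (theta_gt0 : 0 < theta)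
    (gamma_gtN3 : -3 < gamma) (gamma_le1 : gamma <= 1)
    (b_int : lebesgue_measure.-integrable `[(-1 : R), 1] (EFin \o b))
    (N_odd : odd N) (O_orth : orthogonal_mx O) :
  forall f : 'cV[R]_3 -> R,
    (collision_domain gamma b (rotate_about u O f) <->
       collision_domain gamma b f) /\
    (collision_domain gamma b f ->
       approx_collision rho theta u gamma b N (rotate_about u O f) =
       rotate_about u O (approx_collision rho theta u gamma b N f)).
Proof.
move=> f; rewrite !rotate_aboutE; split.
  exact: collision_domain_rotation_about.
by move=> _; exact: approx_collision_rotation_about.
Qed.
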